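(* Let $\mathbb{K}$ be an algebraically closed field and let $\mathbb{K}\{\!\{t\}\!\}$ be the field of formal Puiseux series over $\mathbb{K}$. Let $M$ be a matroid of rank $d$ on the ground set $[n]$. The corank vector $\rho(M)$ can be lifted to an ordinary Plücker vector over $\mathbb{K}\{\!\{t\}\!\}$ if and only if $M$ is realizable over $\mathbb{K}$.
   Context: The corank vector of $M$ is the map $\rho(M):\binom{[n]}{d}\to\mathbb{N}$, $S\mapsto d-\operatorname{rk}_M(S)$. The valuation $\operatorname{val}:\mathbb{K}\{\!\{t\}\!\}\to\mathbb{R}\cup\{\infty\}$ sends a Puiseux series to the exponent of its term of lowest order. A vector $\pi\in\mathbb{R}^{\binom{n}{d}}$ can be lifted to an ordinary Plücker vector over $\mathbb{K}\{\!\{t\}\!\}$ if there is a matrix $A\in\mathbb{K}\{\!\{t\}\!\}^{d\times n}$ such that $\operatorname{val}(\det A_I)=\pi_I$ for every $d$-element subset $I\subseteq[n]$, where $A_I$ is the $d\times d$ submatrix with columns indexed by $I$. The matroid $M$ is realizable over $\mathbb{K}$ if there is a matrix $B\in\mathbb{K}^{d\times n}$ such that the bases of $M$ are exactly the $d$-subsets $I$ with $\det B_I\neq 0$. *)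

(* Defs.v *)
From HB Require Import structures.
From mathcomp Require Import all_boot all_order all_algebra.
From mathcomp Require Import boolp classical_sets functions cardinality fsbigop.
From mathcomp Require Import constructive_ereal reals.

Set Implicit Arguments.
Unset Strict Implicit.
Unset Printing Implicit Defensive.

Import Order.TTheory GRing.Theory Num.Theory.

Local Open Scope ring_scope.

Section PuiseuxDef.
Variable K : fieldType.

(* The formal series \sum_q f(q) t^q has a common denominator N for its
   exponents, and these exponents are bounded below. *)
Definition is_puiseux (f : rat -> K) : Prop :=
  exists2 N : nat, (0 < N)%N & exists m : int,
    forall q : rat, f q != 0 -> exists2 k : int, m <= k & q = k%:~R / N%:R.

Definition puiseux_pred : {pred (rat -> K)} := fun f => `[< is_puiseux f >].

Record puiseux : Type :=
  Puiseux { pcoef : rat -> K ; _ : pcoef \in puiseux_pred }.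

HB.instance Definition _ := [isSub for pcoef].
HB.instance Definition _ := [Choice of puiseux by <:].

(* The summand has finite support when f and g satisfy is_puiseux. *)
Definition cauchy_mul (f g : rat -> K) : rat -> K :=
  fun q => \sum_(p \in [set: rat]%classic) (f p * g (q - p)).

Definition monomial0 : rat -> K := fun q => (q == 0)%:R.

End PuiseuxDef.

Section PuiseuxTheory.
Variable K : fieldType.
Implicit Types (f g h : rat -> K) (N k i j : nat) (a b : int) (q : rat).

(* The denominator of pexp and psupp is N.+1, so that it is never 0. *)
Definition pexp N a k : rat := (a%:~R + k%:R) / N.+1%:R.

Definition psupp N a f := forall q, f q != 0 -> exists k, q = pexp N a k.

Lemma pexpD N a b i j : pexp N a i + pexp N b j = pexp N (a + b) (i + j).
Proof. by rewrite /pexp -mulrDl intrD natrD addrACA. Qed.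

Lemma pexp_inj N a : injective (pexp N a).
Proof.
move=> i j; rewrite /pexp => /mulIf; rewrite invr_eq0 pnatr_eq0 => /(_ isT).
by move=> /addrI /eqP; rewrite eqr_nat => /eqP.
Qed.

Lemma puiseuxP f : is_puiseux f <-> exists N a, psupp N a f.
Proof.
split=> [[[//|N] _ [m fm]]|[N [a fa]]].
  exists N, m => q /fm[k mk ->]; exists `|k - m|%N.
  by rewrite /pexp -[X in _ + X]/(`|k - m|%N%:~R) -intrD gez0_abs ?subr_ge0// [m + _]addrC subrK.
exists N.+1 => //; exists a => q /fa[k ->]; exists (a + k%:Z).
  by rewrite lerDl.
by rewrite /pexp intrD.
Qed.

Lemma psupp_widen N a b f : b <= a -> psupp N a f -> psupp N b f.
Proof.
move=> ba fa q /fa[k ->]; exists (`|a - b| + k)%N.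
rewrite /pexp natrD -[`|_|%N%:R]/(`|_|%N%:~R) gez0_abs ?subr_ge0// addrA -intrD.
by rewrite [b + _]addrC subrK.
Qed.

Lemma psupp_scale N M a f : psupp N a f ->
  psupp (N.+1 * M.+1).-1 (a * M.+1%:Z) f.
Proof.
move=> fa q /fa[k ->]; exists (k * M.+1)%N; rewrite /pexp prednK ?muln_gt0//.
rewrite intrM -[_.+1%:Z%:~R]/(_.+1%:R) !natrM -mulrDl -mulf_div divff ?mulr1//.
by rewrite pnatr_eq0.
Qed.

Lemma psupp2 f g : is_puiseux f -> is_puiseux g ->
  exists N a, psupp N a f /\ psupp N a g.
Proof.
move=> /puiseuxP[N [a fa]] /puiseuxP[M [b gb]].
exists (N.+1 * M.+1).-1, (Num.min (a * M.+1%:Z) (b * N.+1%:Z)); split.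
  by apply: (psupp_widen _ (psupp_scale M fa)); rewrite ge_min lexx.
rewrite [(N.+1 * _)%N]mulnC.
by apply: (psupp_widen _ (psupp_scale N gb)); rewrite ge_min lexx orbT.
Qed.

Lemma psupp3 f g h : is_puiseux f -> is_puiseux g -> is_puiseux h ->
  exists N a, [/\ psupp N a f, psupp N a g & psupp N a h].
Proof.
move=> pf pg /puiseuxP[M [b hb]].
have [N [a [fa ga]]] := psupp2 pf pg.
exists (N.+1 * M.+1).-1, (Num.min (a * M.+1%:Z) (b * N.+1%:Z)); split.
- by apply: (psupp_widen _ (psupp_scale M fa)); rewrite ge_min lexx.
- by apply: (psupp_widen _ (psupp_scale M ga)); rewrite ge_min lexx.
rewrite [(N.+1 * _)%N]mulnC.
by apply: (psupp_widen _ (psupp_scale N hb)); rewrite ge_min lexx orbT.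
Qed.

Lemma psupp_ext N a f g : psupp N a f -> psupp N a g ->
  (forall k, f (pexp N a k) = g (pexp N a k)) -> f = g.
Proof.
move=> fa ga fg; apply/funext => q.
have [fq0|/fa[k ->]//] := eqVneq (f q) 0.
by have [->//|/ga[k ->]] := eqVneq (g q) 0.
Qed.

Lemma psupp_mul N a b f g : psupp N a f -> psupp N b g ->
  psupp N (a + b) (cauchy_mul f g).
Proof.
move=> fa gb q; have [//|ne] := pselect (exists k, q = pexp N (a + b) k).
rewrite /cauchy_mul fsbig1 ?eqxx// => p _.
have [->|/fa[i pi]] := eqVneq (f p) 0; first by rewrite mul0r.
have [->|/gb[j qj]] := eqVneq (g (q - p)) 0; first by rewrite mulr0.
by case: ne; exists (i + j)%N; rewrite -pexpD -pi -qj addrC subrK.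
Qed.

Lemma cauchy_mulE N a b f g k : psupp N a f -> psupp N b g ->
  cauchy_mul f g (pexp N (a + b) k) =
  \sum_(i < k.+1) f (pexp N a i) * g (pexp N b (k - i)).
Proof.
move=> fa gb; rewrite /cauchy_mul.
have pexpB i : (i <= k)%N -> pexp N (a + b) k - pexp N a i = pexp N b (k - i).
  by move=> ik; rewrite -{1}(subnKC ik) -pexpD addrC addKr.
under [RHS]eq_bigr => i _ do rewrite -pexpB ?leq_ord//.
pose F p := f p * g (pexp N (a + b) k - p).
rewrite -[RHS](big_mkord xpredT (fun i => F (pexp N a i))).
rewrite -(big_map (pexp N a) xpredT F).
symmetry; rewrite fsbig_seq; last first.
  by rewrite map_inj_uniq ?iota_uniq//; exact: pexp_inj.
apply: fsbig_widen => // p [_ pn].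
have [fp|/fa[i pi]] := eqVneq (f p) 0; first by rewrite /preimage /= /F fp mul0r.
have [gp|/gb[j qj]] := eqVneq (g (pexp N (a + b) k - p)) 0.
  by rewrite /preimage /= /F gp mulr0.
have /pexp_inj kE : pexp N (a + b) k = pexp N (a + b) (i + j).
  by rewrite -[RHS]pexpD -pi -qj [p + _]addrC subrK.
suff /pn : p \in [seq pexp N a i | i <- index_iota 0 k.+1] by [].
by apply/mapP; exists i; rewrite // mem_index_iota kE ltnS leq_addr.
Qed.

Lemma cauchy_mulE_poly N a b f g k : psupp N a f -> psupp N b g ->
  forall n, (k <= n)%N -> cauchy_mul f g (pexp N (a + b) k) =
  ((\poly_(i < n.+1) f (pexp N a i)) * (\poly_(i < n.+1) g (pexp N b i)))`_k.
Proof.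
move=> fa gb n kn; rewrite (cauchy_mulE _ fa gb) coefM; apply: eq_bigr => i _.
rewrite !coef_poly !ltnS (leq_trans (leq_ord i) kn).
by rewrite (leq_trans (leq_subr _ _) kn).
Qed.

Fact puiseux_mul_closed f g : f \in @puiseux_pred K -> g \in @puiseux_pred K ->
  cauchy_mul f g \in @puiseux_pred K.
Proof.
move=> /asboolP pf /asboolP pg; apply/asboolP/puiseuxP.
have [N [a [fa ga]]] := psupp2 pf pg.
by exists N, (a + a); exact: psupp_mul.
Qed.

Fact monomial0_puiseux : monomial0 K \in @puiseux_pred K.
Proof.
apply/asboolP; exists 1%N => //; exists 0 => q; rewrite /monomial0.
have [->|] := eqVneq q 0; last by rewrite eqxx.
by exists 0; rewrite ?mul0r.
Qed.

Fact puiseux_zmod_closed : zmod_closed (@puiseux_pred K).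
Proof.
split.
  apply/asboolP; exists 1%N => //; exists 0 => q.
  by rewrite [(0 : rat -> K) q]/(0 : K) eqxx.
move=> f g /asboolP pf /asboolP pg; apply/asboolP/puiseuxP.
have [N [a [fa ga]]] := psupp2 pf pg; exists N, a => q.
have -> : (f - g) q = f q - g q by [].
have [->|/fa//] := eqVneq (f q) 0.
by rewrite sub0r oppr_eq0 => /ga.
Qed.

HB.instance Definition _ :=
  GRing.isZmodClosed.Build (rat -> K) (@puiseux_pred K) puiseux_zmod_closed.
HB.instance Definition _ := [SubChoice_isSubZmodule of puiseux K by <:].

Implicit Types u v w : puiseux K.

Lemma pcoefP u : is_puiseux (pcoef u).
Proof. by case: u => f /= /asboolP. Qed.

Definition puiseux_mul u v : puiseux K :=
  Puiseux (puiseux_mul_closed (valP u) (valP v)).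

Definition puiseux_one : puiseux K := Puiseux monomial0_puiseux.

Fact puiseux_mulC : commutative puiseux_mul.
Proof.
move=> u v; apply: val_inj => /=.
have [N [a [ua va]]] := psupp2 (pcoefP u) (pcoefP v).
apply: (psupp_ext (psupp_mul ua va) (psupp_mul va ua)) => k.
by rewrite !(cauchy_mulE_poly _ _ (leqnn k))// mulrC.
Qed.

Fact puiseux_mulA : associative puiseux_mul.
Proof.
move=> u v w; apply: val_inj => /=.
have [N [a [ua va wa]]] := psupp3 (pcoefP u) (pcoefP v) (pcoefP w).
have H1 := psupp_mul ua (psupp_mul va wa).
have := psupp_mul (psupp_mul ua va) wa; rewrite -addrA => H2.
apply: (psupp_ext H1 H2) => k.
rewrite (cauchy_mulE _ ua (psupp_mul va wa)) [in RHS]addrA.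
rewrite (cauchy_mulE _ (psupp_mul ua va) wa).
pose P (x : puiseux K) : {poly K} := \poly_(i < k.+1) pcoef x (pexp N a i).
transitivity ((P u * (P v * P w))`_k).
  rewrite coefM; apply: eq_bigr => i _.
  by rewrite coef_poly ltnS leq_ord (cauchy_mulE_poly va wa (leq_subr i k)).
rewrite mulrA coefM; apply: eq_bigr => i _.
rewrite (cauchy_mulE_poly ua va (leq_ord i)) [(P w)`_ _]coef_poly.
by rewrite ltnS leq_subr.
Qed.

Fact puiseux_mul1 : left_id puiseux_one puiseux_mul.
Proof.
move=> u; apply: val_inj => /=; apply/funext => q; rewrite /cauchy_mul.
rewrite -(fsbig_widen [set 0]%classic)//.
  by rewrite fsbig_set1 /monomial0 eqxx mul1r subr0.
by move=> p [_ /= /eqP/negbTE p0]; rewrite /monomial0 p0 mul0r.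
Qed.

Fact puiseux_mulDl : left_distributive puiseux_mul +%R.
Proof.
move=> u v w; apply: val_inj.
have [N [a [ua va wa]]] := psupp3 (pcoefP u) (pcoefP v) (pcoefP w).
have uva : psupp N a (pcoef (u + v)).
  move=> q; have -> : pcoef (u + v) q = pcoef u q + pcoef v q by [].
  have [->|/ua//] := eqVneq (pcoef u q) 0.
  by rewrite add0r => /va.
have sa : psupp N (a + a) (pcoef (puiseux_mul u w + puiseux_mul v w)).
  move=> q; have -> : pcoef (puiseux_mul u w + puiseux_mul v w) q =
    cauchy_mul (pcoef u) (pcoef w) q + cauchy_mul (pcoef v) (pcoef w) q by [].
  have [->|/(psupp_mul ua wa)//] := eqVneq (cauchy_mul (pcoef u) (pcoef w) q) 0.
  by rewrite add0r => /(psupp_mul va wa).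
apply: (psupp_ext (psupp_mul uva wa) sa) => k.
have -> : val (puiseux_mul u w + puiseux_mul v w) (pexp N (a + a) k) =
  cauchy_mul (pcoef u) (pcoef w) (pexp N (a + a) k) +
  cauchy_mul (pcoef v) (pcoef w) (pexp N (a + a) k) by [].
rewrite (cauchy_mulE k ua wa) (cauchy_mulE k va wa) -big_split.
rewrite [LHS](cauchy_mulE k uva wa).
by apply: eq_bigr => i _; rewrite /= -mulrDl.
Qed.

Fact puiseux_one_neq0 : puiseux_one != 0.
Proof.
apply/eqP => /(congr1 (fun u => pcoef u 0)) /eqP.
rewrite [pcoef 0 0]/(0 : K) /= /monomial0 eqxx.
by rewrite (negbTE (oner_neq0 _)).
Qed.

HB.instance Definition _ := GRing.Zmodule_isComNzRing.Build (puiseux K)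
  puiseux_mulA puiseux_mulC puiseux_mul1 puiseux_mulDl puiseux_one_neq0.

Lemma psupp_lead u : u != 0 ->
  exists N a, psupp N a (pcoef u) /\ pcoef u (pexp N a 0) != 0.
Proof.
move=> u0; have /puiseuxP[N [a ua]] := pcoefP u.
have [q uq] : exists q, pcoef u q != 0.
  apply: contrapT => /forallNP uz; case/eqP: u0; apply: val_inj.
  apply/funext => q; rewrite [RHS]/(0 : K).
  by apply/eqP/negbNE/negP; exact: uz.
have exk : exists k, pcoef u (pexp N a k) != 0.
  by have [k qk] := ua q uq; exists k; rewrite -qk.
case: (ex_minnP exk) => m um mmin.
have em k : pexp N (a + m%:Z) k = pexp N a (m + k).
  by rewrite /pexp intrD natrD addrA.
exists N, (a + m%:Z); rewrite em addn0; split => // p up.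
have [k pk] := ua p up; exists (k - m)%N.
by rewrite em subnKC// mmin// -pk.
Qed.

Definition inv_seq (s : nat -> K) := fix inv_seq n : seq K :=
  if n is n'.+1 then
    rcons (inv_seq n')
      ((s 0%N)^-1 * ((n' == 0%N)%:R
         - \sum_(i < n') s (n' - i)%N * (inv_seq n')`_i))
  else [::].

Lemma power_inv (s : nat -> K) : s 0%N != 0 ->
  exists r : nat -> K, forall k,
    \sum_(i < k.+1) r i * s (k - i)%N = (k == 0%N)%:R.
Proof.
move=> s0; have sz n : size (inv_seq s n) = n.
  by elim: n => //= n IH; rewrite size_rcons IH.
have nthS n i : (i < n)%N -> (inv_seq s n)`_i = (inv_seq s i.+1)`_i.
  elim: n => // n IH; rewrite ltnS leq_eqVlt => /orP[/eqP->//|lt].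
  by rewrite [LHS]nth_rcons sz lt IH.
exists (fun i => (inv_seq s i.+1)`_i) => k.
rewrite big_ord_recr /= subnn nth_rcons sz ltnn eqxx.
rewrite [(_^-1 * _) * _]mulrAC mulVf// mul1r addrC.
under [X in _ - X + _]eq_bigr => i _ do rewrite (nthS _ _ (ltn_ord i)) mulrC.
by rewrite subrK.
Qed.

Fact puiseux_has_inv u : u != 0 -> exists v, v * u = 1.
Proof.
move=> /psupp_lead[N [a [ua u0]]].
have [r rP] := power_inv (s := fun k => pcoef u (pexp N a k)) u0.
pose g q := if pselect (exists k, q = pexp N (- a) k) is left ex
            then r (projT1 (cid ex)) else 0.
have gE k : g (pexp N (- a) k) = r k.
  rewrite /g; case: pselect => [ex|[]]; last by exists k.
  by case: (cid ex) => j /= /pexp_inj ->.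
have ga : psupp N (- a) g.
  by move=> q; rewrite /g; case: pselect => // _; rewrite eqxx.
have pg : g \in @puiseux_pred K by apply/asboolP/puiseuxP; exists N, (- a).
exists (Puiseux pg); apply: val_inj.
have e0 k : pexp N (- a + a) k = k%:R / N.+1%:R by rewrite /pexp addNr add0r.
have s1 : psupp N (- a + a) (monomial0 K).
  move=> q; rewrite /monomial0; have [-> _|] := eqVneq q 0; last by rewrite eqxx.
  by exists 0%N; rewrite e0 mul0r.
apply: (psupp_ext (psupp_mul ga ua) s1) => k.
rewrite (cauchy_mulE _ ga ua); under eq_bigr => i _ do rewrite gE.
by rewrite rP /monomial0 e0 mulf_eq0 invr_eq0 !pnatr_eq0 orbF.
Qed.

Definition puiseux_inv u : puiseux K :=
  if pselect (exists v, v * u = 1) is left ex then projT1 (cid ex) else 0.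

Fact puiseux_mulVf u : u != 0 -> puiseux_inv u * u = 1.
Proof.
move=> /puiseux_has_inv ex; rewrite /puiseux_inv.
by case: pselect => // ex'; case: (cid ex').
Qed.

Fact puiseux_inv0 : puiseux_inv 0 = 0.
Proof.
rewrite /puiseux_inv; case: pselect => // ex; have [v /esym/eqP] := ex.
by rewrite mulr0 oner_eq0.
Qed.

HB.instance Definition _ :=
  GRing.ComNzRing_isField.Build (puiseux K) puiseux_mulVf puiseux_inv0.

End PuiseuxTheory.

Section Valuation.
Variables (R : realType) (K : fieldType).

Definition lowest_exponent (u : puiseux K) (q : rat) : Prop :=
  pcoef u q != 0 /\ forall p, pcoef u p != 0 -> q <= p.

Definition puiseux_val (u : puiseux K) : \bar R :=
  if u == 0 then +oo%E else (ratr (xget 0 (lowest_exponent u)))%:E.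

Lemma puiseux_val_lowest u : u != 0 ->
  exists2 q, lowest_exponent u q & puiseux_val u = (ratr q)%:E.
Proof.
move=> u0; rewrite /puiseux_val (negbTE u0).
exists (xget 0 (lowest_exponent u)) => //; apply: xgetPex.
have [N [a [ua ua0]]] := psupp_lead u0.
exists (pexp N a 0); split=> // p /ua[k ->].
by rewrite /pexp addr0 ler_pM2r ?invr_gt0 ?ltr0n// lerDl ler0n.
Qed.

End Valuation.

Section Matroid.
Variable T : finType.

Record matroid : Type := Matroid {
  indep : {set {set T}} ;
  indep0 : finset.set0 \in indep ;
  indepS : forall I J : {set T}, J \in indep -> I \subset J -> I \in indep ;
  indep_augment : forall I J : {set T}, I \in indep -> J \in indep ->
    (#|I| < #|J|)%N -> exists2 x, x \in J :\: I & x |: I \in indep }.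

Definition matroid_bases (M : matroid) : {set {set T}} :=
  [set B : {set T} | maxset [pred I | I \in indep M] B]%SET.

Definition matroid_rk (M : matroid) (S : {set T}) : nat :=
  \max_(I in indep M | I \subset S) #|I|.

Definition matroid_rank (M : matroid) : nat := matroid_rk M [set: T]%SET.

End Matroid.

Definition dsubset (n d : nat) : finType := {I : {set 'I_n} | #|I| == d}.

Section Realizability.
Variables n d : nat.

(* enum_val lists the columns of I in increasing order. *)
Definition columns (F : Type) (A : 'M[F]_(d, n)) (I : dsubset n d) : 'M[F]_d :=
  colsub (fun j : 'I_d =>
    enum_val (cast_ord (esym (eqP (valP I))) j)) A.

Definition corank_vector (M : matroid 'I_n) : {ffun dsubset n d -> nat} :=
  [ffun S => (d - matroid_rk M (val S))%N].

Definition plucker_liftable (R : realType) (K : fieldType)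
    (w : {ffun dsubset n d -> R}) : Prop :=
  exists A : 'M[puiseux K]_(d, n),
    forall I, puiseux_val R (\det (columns A I)) = (w I)%:E.

Definition realizable (K : fieldType) (M : matroid 'I_n) : Prop :=
  exists B : 'M[K]_(d, n),
    matroid_bases M =
      [set val I | I : dsubset n d & \det (columns B I) != 0]%SET.

End Realizability.

(* Main.v *)
(* If A lifts the corank vector, its maximal minors have nonnegative valuation,
   and the minor at some basis I0 of M has valuation 0.  The entries of
   A' = adj(A_I0) A are, up to sign, maximal minors of A or 0, so A' reduces
   modulo the maximal ideal of the valuation ring to a matrix B over K; since
   det(A_I0) det(A'_I) = det(A_I0)^d det(A_I), the minor det(B_I) is nonzero iff
   det(A_I) has valuation 0, that is, iff I is a basis.

   Conversely, if B realizes M, then A = B + t C lifts the corank vector for a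
   generic C over K: t^(d - rk B_I) divides det(B_I + t C_I), with a coefficient
   that is a nonzero polynomial in the entries of C.  As K is infinite, these
   finitely many coefficients are simultaneously nonzero for some C. *)
From HB Require Import structures.
From mathcomp Require Import boolp classical_sets fsbigop constructive_ereal.
Require Import Defs.
From mathcomp Require Import all_boot all_order all_algebra perm.
From mathcomp Require Import reals.
Import Order.TTheory GRing.Theory Num.Theory.
Local Open Scope ring_scope.

Set Implicit Arguments.
Unset Strict Implicit.
Unset Printing Implicit Defensive.

(** * Puiseux series of nonnegative valuation and their residues *)

Section Puiseux.
Variable K : fieldType.
Implicit Types (u v : puiseux K) (p q : rat) (c : K).

Definition supp_ge q u := forall p, pcoef u p != 0 -> q <= p.

Lemma supp_ge_small q u p : supp_ge q u -> p < q -> pcoef u p = 0.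
Proof. by move=> uq; rewrite ltNge => /negP qp; apply/eqP/negPn/negP => /uq. Qed.

Lemma pcoef_mul u v : pcoef (u * v) = cauchy_mul (pcoef u) (pcoef v).
Proof. by []. Qed.

Lemma supp_geM p q u v : supp_ge p u -> supp_ge q v -> supp_ge (p + q) (u * v).
Proof.
move=> up vq s; apply: contraR; rewrite -ltNge => spq.
rewrite pcoef_mul /cauchy_mul fsbig1 ?eqxx// => r _.
have [rp|pr] := ltP r p; first by rewrite (supp_ge_small up rp) mul0r.
rewrite (supp_ge_small vq) ?mulr0// ltrBlDl (lt_le_trans spq)//.
by rewrite lerD2r.
Qed.

(** In the convolution only the term at [p] survives: below [p] the coefficient of [u] vanishes, and
    above [p] the complementary exponent drops below [q]. *)
Lemma pcoefM p q u v : supp_ge p u -> supp_ge q v ->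
  pcoef (u * v) (p + q) = pcoef u p * pcoef v q.
Proof.
move=> up vq; rewrite pcoef_mul /cauchy_mul -(fsbig_widen [set p]%classic)//.
  by rewrite fsbig_set1 [p + q]addrC addrK.
move=> r [_ /= /eqP]; rewrite neq_lt => /orP[rp|pr].
  by rewrite (supp_ge_small up rp) mul0r.
by rewrite (supp_ge_small vq) ?mulr0// ltrBlDl ltrD2r.
Qed.

Lemma pcoefB u v q : pcoef (u - v) q = pcoef u q - pcoef v q.
Proof. by []. Qed.

(* u lies in the valuation ring and c is its image in the residue field. *)
Definition residue u c := supp_ge 0 u /\ pcoef u 0 = c.

Lemma residue0 : residue 0 0.
Proof. by split=> // q; rewrite [pcoef _ _]/(0 : K) eqxx. Qed.

Lemma residue1 : residue 1 1.
Proof.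
split; rewrite ?[LHS]/((0 == 0)%:R : K) ?eqxx// => q.
rewrite [pcoef _ _]/((q == 0)%:R : K).
by have [->|] := eqVneq q 0; rewrite ?eqxx.
Qed.

Lemma residueB u v a b : residue u a -> residue v b -> residue (u - v) (a - b).
Proof.
move=> [u0 <-] [v0 <-]; split=> // q.
rewrite pcoefB.
have [->|/u0//] := eqVneq (pcoef u q) 0.
by rewrite sub0r oppr_eq0 => /v0.
Qed.

Lemma residueN u a : residue u a -> residue (- u) (- a).
Proof. by move=> /(residueB residue0); rewrite !sub0r. Qed.

Lemma residueD u v a b : residue u a -> residue v b -> residue (u + v) (a + b).
Proof. by move=> ua /residueN /(residueB ua); rewrite !opprK. Qed.

Lemma residueM u v a b : residue u a -> residue v b -> residue (u * v) (a * b).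
Proof.
move=> [u0 <-] [v0 <-]; split; last by rewrite -(pcoefM u0 v0) addr0.
by rewrite -[0]addr0; exact: supp_geM.
Qed.

Lemma residueX u a n : residue u a -> residue (u ^+ n) (a ^+ n).
Proof.
move=> ua; elim: n => [|n IH]; first exact: residue1.
by rewrite !exprS; exact: residueM.
Qed.

(** The Leibniz formula uses only sums, products and signs, all compatible with [residue]. *)
Lemma residue_det n (A : 'M[puiseux K]_n) (B : 'M[K]_n) :
  (forall i j, residue (A i j) (B i j)) -> residue (\det A) (\det B).
Proof.
move=> AB; apply: (big_ind2 residue).
- exact: residue0.
- by move=> *; exact: residueD.
- move=> s _; apply: residueM.
    by apply: residueX; apply/residueN/residue1.
  apply: (big_ind2 residue) => //; first exact: residue1.
  by move=> *; exact: residueM.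
Qed.

Lemma residueS u : supp_ge 0 u -> residue u (pcoef u 0).
Proof. by []. Qed.

(** * Polynomials as Puiseux series, with ['X] as the parameter t *)

Definition poly_coef (P : {poly K}) : rat -> K :=
  fun q => if q \is a Num.nat then P`_(Num.trunc q) else 0.

Lemma poly_coef_nat P k : poly_coef P k%:R = P`_k.
Proof. by rewrite /poly_coef natr_nat natrK. Qed.

Lemma pexp00 k : pexp 0 0 k = k%:R.
Proof. by rewrite /pexp add0r divr1. Qed.

(** In [psupp 0 0] the denominator is [0.+1 = 1], so the allowed exponents are the natural
    numbers. *)
Lemma poly_coef_psupp P : psupp 0 0 (poly_coef P).
Proof.
move=> q; rewrite /poly_coef; case: ifP => [qn _|_]; last by rewrite eqxx.
by exists (Num.trunc q); rewrite pexp00 truncnK.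
Qed.

Fact poly_coef_puiseux P : poly_coef P \in @puiseux_pred K.
Proof. by apply/asboolP/puiseuxP; exists 0%N, 0; exact: poly_coef_psupp. Qed.

Definition poly_puiseux P : puiseux K := Puiseux (poly_coef_puiseux P).

Fact poly_puiseux_zmod_morphism : zmod_morphism poly_puiseux.
Proof.
move=> P Q; apply: val_inj; apply/funext => q.
transitivity (poly_coef P q - poly_coef Q q) => //=; rewrite /poly_coef.
by case: ifP; rewrite ?subr0// coefB.
Qed.

Fact poly_puiseux_monoid_morphism : monoid_morphism poly_puiseux.
Proof.
split=> [|P Q]; apply: val_inj.
  apply/funext => q; rewrite [RHS]/((q == 0)%:R) /= /poly_coef coef1.
  case: ifP => [/truncnK {2}<-|qn]; first by rewrite pnatr_eq0.
  by case: eqVneq qn => // ->; rewrite rpred0.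
have supp0 R := @poly_coef_psupp R.
apply: (psupp_ext (supp0 _) (psupp_mul (supp0 P) (supp0 Q))) => k.
rewrite (cauchy_mulE k (supp0 P) (supp0 Q)) pexp00 poly_coef_nat coefM.
by apply: eq_bigr => i _; rewrite !pexp00 !poly_coef_nat.
Qed.

HB.instance Definition _ := GRing.isZmodMorphism.Build _ _ poly_puiseux
  poly_puiseux_zmod_morphism.
HB.instance Definition _ := GRing.isMonoidMorphism.Build _ _ poly_puiseux
  poly_puiseux_monoid_morphism.

Lemma lowest_exponent_poly (P : {poly K}) m : P`_m != 0 ->
  (forall i, (i < m)%N -> P`_i = 0) -> lowest_exponent (poly_puiseux P) m%:R.
Proof.
move=> Pm Plt; split=> [|q]; rewrite /= ?poly_coef_nat// /poly_coef.
case: ifP => [/truncnK {2}<-|]; last by rewrite eqxx.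
by rewrite ler_nat leqNgt; apply: contraNN => /Plt ->.
Qed.

(** Moves valuations from [R] to rational exponents. The zero series satisfies neither side;
    otherwise the lowest exponent is unique and [ratr] is injective. *)
Lemma puiseux_valP (R : realType) u q :
  puiseux_val R u = (ratr q)%:E <-> lowest_exponent u q.
Proof.
split=> [|[uq qmin]].
  have [->|u0] := eqVneq u 0; first by rewrite /puiseux_val eqxx.
  have [p up ->] := puiseux_val_lowest R u0; case=> /eqP.
  by rewrite (inj_eq (fmorph_inj _)) => /eqP <-.
have [u0|/(puiseux_val_lowest R)[p [up pmin] ->]] := eqVneq u 0.
  by move: uq; rewrite u0 [pcoef _ _]/(0 : K) eqxx.
by congr (ratr _)%:E; apply: le_anti; rewrite pmin// qmin.
Qed.

End Puiseux.

(** * Maximal minors and Cramer's rule *)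

Section ColumnDeterminants.
Variables (n d : nat).

Definition column_index (I : dsubset n d) (j : 'I_d) : 'I_n :=
  enum_val (cast_ord (esym (eqP (valP I))) j).

Lemma column_index_inj I : injective (column_index I).
Proof. by move=> i j /enum_val_inj /cast_ord_inj. Qed.

Lemma column_index_mem I j : column_index I j \in val I.
Proof. exact: enum_valP. Qed.

Lemma column_index_onto (I : dsubset n d) x :
  x \in val I -> exists j, column_index I j = x.
Proof.
move=> xI; exists (cast_ord (eqP (valP I)) (enum_rank_in xI x)).
by rewrite /column_index cast_ordK enum_rankK_in.
Qed.

Lemma columnsE F (A : 'M[F]_(d, n)) I : columns A I = colsub (column_index I) A.
Proof. by []. Qed.

Lemma columns_map F G (f : F -> G) (A : 'M_(d, n)) I :
  columns (map_mx f A) I = map_mx f (columns A I).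
Proof. by apply/matrixP => i j; rewrite !mxE. Qed.

(** Extends a square block prescribed at [I] to a full matrix, with zeros in the other columns. *)
Lemma columns_onto (F : pzSemiRingType) I (D : 'M[F]_d) :
  exists A : 'M_(d, n), columns A I = D.
Proof.
exists (\matrix_(i, j) \sum_k D i k *+ (column_index I k == j)).
apply/matrixP => i l; rewrite columnsE !mxE (bigD1 l)//= eqxx mulr1n.
rewrite big1 ?addr0// => k kl.
by rewrite (inj_eq (@column_index_inj I)) (negbTE kl).
Qed.

(** A repeated column kills the determinant; otherwise the selected columns are those of the image
    of [f], up to a permutation. *)
Lemma det_colsub (F : comNzRingType) (A : 'M[F]_(d, n)) (f : 'I_d -> 'I_n) :
  \det (colsub f A) = 0 \/
  exists I (b : bool), \det (colsub f A) = (-1) ^+ b * \det (columns A I).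
Proof.
have [/injectiveP f_inj|/injectivePn[i [j ij fij]]] := boolP (injectiveb f);
    last first.
  left; rewrite -det_tr; apply: (determinant_alternate ij) => k.
  by rewrite !mxE fij.
right; have cardI : #|f @: [set: 'I_d]| == d.
  by rewrite card_imset// cardsT card_ord.
pose I : dsubset n d := Sub (f @: [set: 'I_d])%SET cardI.
(* The position of [f i] in the increasing list of [I]; these positions form the permutation [s]. *)
have ex i : exists j, column_index I j == f i.
  have [|j <-] := @column_index_onto I (f i); first exact: imset_f.
  by exists j.
have sE i := eqP (xchooseP (ex i)).
have s_inj : injective (fun i => xchoose (ex i)).
  by move=> i j /(congr1 (column_index I)); rewrite !sE => /f_inj.
pose s := perm s_inj; exists I, (odd_perm s^-1).
have -> : colsub f A = col_perm s (columns A I).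
  by apply/matrixP => i j; rewrite columnsE !mxE permE sE.
by rewrite col_permE det_mulmx det_perm mulrC.
Qed.

(** Laplace expansion along column [i]: replacing that column of the block by column [j] of [A]
    leaves its cofactors unchanged. Together with [det_colsub], every entry is 0 or a signed maximal
    minor. *)
Lemma adj_mulmx_colsub (F : comNzRingType) (A : 'M[F]_(d, n)) e i j :
  (\adj (colsub e A) *m A) i j =
  \det (colsub (fun l => if l == i then j else e l) A).
Proof.
rewrite (expand_det_col _ i) mxE; apply: eq_bigr => k _.
rewrite !mxE eqxx mulrC; congr (_ * (_ * \det _)).
by apply/matrixP => a b; rewrite !mxE eq_sym (negbTE (neq_lift _ _)).
Qed.

End ColumnDeterminants.

(** * The linear matroid on the rows of a matrix *)

Section RowSpan.
Variables (F : fieldType) (n m : nat) (A : 'M[F]_(n, m)).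
Implicit Types S J : {set 'I_n}.

Definition rowspan S : 'M[F]_m := (\sum_(i in S) <<row i A>>)%MS.
Definition row_indep J := \rank (rowspan J) == #|J|.

Lemma row_sub_rowspan i S : i \in S -> (row i A <= rowspan S)%MS.
Proof. by move=> iS; apply: (sumsmx_sup i); rewrite ?genmxE. Qed.

Lemma rowspan_subP m' S (B : 'M_(m', m)) :
  reflect (forall i, i \in S -> (row i A <= B)%MS) (rowspan S <= B)%MS.
Proof.
by apply: (iffP sumsmx_subP) => SB i /SB; rewrite genmxE.
Qed.

Lemma rowspanS S J : S \subset J -> (rowspan S <= rowspan J)%MS.
Proof.
by move=> SJ; apply/rowspan_subP => i /(subsetP SJ); exact: row_sub_rowspan.
Qed.

Lemma rank_rowspan_card S : (\rank (rowspan S) <= #|S|)%N.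
Proof.
rewrite -sum1_card; apply: leq_trans (mxrank_sum_leqif _) _ => /=.
by apply: leq_sum => i _; rewrite mxrank_gen rank_leq_row.
Qed.

Lemma rank_rowspanU S J :
  (\rank (rowspan (S :|: J)) <= \rank (rowspan S) + \rank (rowspan J))%N.
Proof.
apply: leq_trans (mxrank_adds_leqif _ _); apply: mxrankS.
apply/rowspan_subP => i /setUP[] /row_sub_rowspan iS; apply: submx_trans iS _.
  exact: addsmxSl.
exact: addsmxSr.
Qed.

(** Rank is subadditive and [J :\: S] contributes at most its cardinality, so [S] must contribute
    all of its own. *)
Lemma row_indepS S J : row_indep J -> S \subset J -> row_indep S.
Proof.
move=> /eqP Jind SJ; rewrite /row_indep eqn_leq rank_rowspan_card /=.
rewrite -(leq_add2r #|J :\: S|).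
have -> : (#|S| + #|J :\: S| = #|J|)%N.
  by rewrite -(cardsID S J) (setIidPr SJ).
rewrite -Jind -{1}(setID J S) (setIidPr SJ).
apply: leq_trans (rank_rowspanU _ _) _.
by rewrite leq_add2l rank_rowspan_card.
Qed.

(** Take [J'] maximal among the independent sets between [J] and [S]: a row of [S] outside its span
    would raise the rank and could be added. *)
Lemma row_indep_extend J S : row_indep J -> J \subset S ->
  exists J', [/\ J \subset J', J' \subset S, row_indep J' &
                 \rank (rowspan J') = \rank (rowspan S)].
Proof.
move=> Jind JS.
have [|J' /maxsetP[/andP[J'ind J'S] J'max] JJ'] :=
    @maxset_exists _ [pred T | row_indep T && (T \subset S)] J.
  by rewrite /= Jind.
exists J'; split=> //; apply/eqP; rewrite (mxrank_leqif_sup (rowspanS J'S)).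
apply/rowspan_subP => i iS.
have lt_rank : ~~ (row i A <= rowspan J')%MS ->
    (\rank (rowspan J') < \rank (rowspan (i |: J')))%N.
  apply: contraNltn.
  rewrite (geq_leqif (mxrank_leqif_sup (rowspanS (subsetUr _ _)))).
  by move=> /rowspan_subP; apply; rewrite setU11.
apply: contraT => iJ'; have [iin|iout] := boolP (i \in J').
  by rewrite row_sub_rowspan in iJ'.
suff J'E : i |: J' = J' by move: iout; rewrite -J'E setU11.
apply: J'max; rewrite ?subsetUr//= subUset sub1set iS J'S andbT.
rewrite /row_indep eqn_leq rank_rowspan_card cardsU1 iout add1n.
by rewrite -(eqP J'ind) lt_rank.
Qed.

End RowSpan.

Lemma rank_columns (F : fieldType) (n d : nat) (A : 'M[F]_(d, n)) I :
  \rank (columns A I) = \rank (rowspan A^T (val I)).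
Proof.
rewrite -mxrank_tr; apply/eqmx_rank/andP; split.
  apply/row_subP => j; rewrite columnsE.
  have -> : row j (colsub (column_index I) A)^T = row (column_index I j) A^T.
    by apply/rowP => k; rewrite !mxE.
  by rewrite row_sub_rowspan// column_index_mem.
apply/rowspan_subP => _ /column_index_onto[j <-].
have -> : row (column_index I j) A^T = row j (columns A I)^T.
  by apply/rowP => k; rewrite columnsE !mxE.
exact: row_sub.
Qed.

Lemma det_neq0_rank (F : fieldType) d (A : 'M[F]_d) :
  (\det A != 0) = (\rank A == d).
Proof. by rewrite -unitfE -unitmxE -row_free_unit. Qed.

(** * Rank and bases of an abstract matroid *)

Section MatroidRank.
Variables (T : finType) (M : matroid T).
Implicit Types S I B : {set T}.

Lemma leq_matroid_rk I S :
  I \in indep M -> I \subset S -> (#|I| <= matroid_rk M S)%N.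
Proof.
by move=> Iind IS; rewrite /matroid_rk (bigD1 I) ?Iind//= leq_maxl.
Qed.

Lemma matroid_rk_witness S :
  exists2 I, I \in indep M & I \subset S /\ #|I| = matroid_rk M S.
Proof.
pose P := [pred I : {set T} | (I \in indep M) && (I \subset S)].
have [|I /andP[Iind IS] rkI] := @eq_bigmax_cond _ P (fun I => #|I|).
  by apply/card_gt0P; exists finset.set0; rewrite inE indep0 sub0set.
by exists I => //; split.
Qed.

Lemma matroid_rk_rank S : (matroid_rk M S <= matroid_rank M)%N.
Proof.
have [I Iind [_ <-]] := matroid_rk_witness S.
by rewrite leq_matroid_rk// finset.subsetT.
Qed.

(** A maximal independent set smaller than the rank could be augmented from an independent set of
    maximum size. *)
Lemma matroid_basesE B :
  (B \in matroid_bases M) = (B \in indep M) && (#|B| == matroid_rank M).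
Proof.
rewrite inE; apply/maxsetP/andP => /= [[Bind Bmax]|[Bind /eqP cardB]].
  split=> //; rewrite eqn_leq leq_matroid_rk ?finset.subsetT//= leqNgt.
  apply/negP => ltB; have [I Iind [_ cardI]] := matroid_rk_witness [set: T].
  rewrite /matroid_rank -cardI in ltB.
  have [x /setDP[_ xB] xBind] := indep_augment Bind Iind ltB.
  by rewrite -(Bmax _ xBind (subsetUr _ _)) setU11 in xB.
split=> // J Jind BJ; apply/esym/eqP; rewrite eqEcard BJ cardB.
by rewrite leq_matroid_rk// finset.subsetT.
Qed.

Lemma matroid_bases_rk B : #|B| = matroid_rank M ->
  (B \in matroid_bases M) = (matroid_rk M B == matroid_rank M).
Proof.
move=> cardB; rewrite matroid_basesE cardB eqxx andbT.
apply/idP/eqP => [Bind|].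
  apply/eqP; rewrite eqn_leq -{2}cardB leq_matroid_rk// andbT.
  exact: matroid_rk_rank.
have [I Iind [IB <-]] := matroid_rk_witness B; rewrite -cardB => cardI.
by suff <- : I = B by []; apply/eqP; rewrite eqEcard IB cardI leqnn.
Qed.

End MatroidRank.

(** * The rank function of a matroid realized by a matrix *)

Section RealizedRank.
Variables (K : fieldType) (n d : nat) (M : matroid 'I_n) (B : 'M[K]_(d, n)).
Hypothesis rankM : matroid_rank M = d.
Hypothesis basesM : matroid_bases M =
  [set val I | I : dsubset n d & \det (columns B I) != 0]%SET.

Lemma bases_row_indep (J : {set 'I_n}) : #|J| = d ->
  (J \in matroid_bases M) = row_indep B^T J.
Proof.
move=> cardJ; pose I : dsubset n d := Sub J (introT eqP cardJ).
rewrite /row_indep cardJ -[J]/(val I) -rank_columns -det_neq0_rank basesM.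
by rewrite mem_imset ?inE//; exact: val_inj.
Qed.

(** A realization prescribes only the bases, so both directions pass through a basis containing
    [J]. *)
Lemma indep_row_indep J : (J \in indep M) = row_indep B^T J.
Proof.
apply/idP/idP => [Jind|Jind].
  have [J' J'max JJ'] := @maxset_exists _ [pred I | I \in indep M] J Jind.
  have J'bases : J' \in matroid_bases M by rewrite inE.
  apply: row_indepS JJ'; rewrite -bases_row_indep//.
  by move: J'bases; rewrite matroid_basesE rankM => /andP[_ /eqP].
(* The basis [I0] shows that the rows of [B^T] have rank at least [d], so an independent [J']
   spanning them has exactly [d] elements. *)
have [I0 I0ind [_]] := matroid_rk_witness M [set: 'I_n].
rewrite -/(matroid_rank M) rankM => cardI0.
have := bases_row_indep cardI0; rewrite matroid_basesE I0ind cardI0 rankM eqxx.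
move=> /esym /eqP rankI0.
have [J' [JJ' _ J'ind rankJ']] := row_indep_extend Jind (finset.subsetT _).
suff cardJ' : #|J'| = d.
  move: J'ind; rewrite -bases_row_indep// matroid_basesE => /andP[J'ind _].
  exact: indepS J'ind JJ'.
apply/eqP; rewrite -(eqP J'ind) eqn_leq rank_leq_row rankJ' -{1}cardI0 -rankI0.
by rewrite mxrankS// rowspanS// finset.subsetT.
Qed.

Lemma matroid_rkE S : matroid_rk M S = \rank (rowspan B^T S).
Proof.
apply/eqP; rewrite eqn_leq; apply/andP; split.
  have [I] := matroid_rk_witness M S; rewrite indep_row_indep => /eqP Iind.
  by move=> [IS <-]; rewrite -Iind mxrankS// rowspanS.
have [||J [_ JS Jind <-]] := @row_indep_extend _ _ _ B^T finset.set0 S.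
- by rewrite -indep_row_indep indep0.
- exact: sub0set.
by rewrite (eqP Jind) leq_matroid_rk// indep_row_indep.
Qed.

End RealizedRank.

(** * The order at 0 of the determinant of a matrix pencil *)

Section Pencil.
Variables (K : fieldType) (d : nat).
Implicit Types B C : 'M[K]_d.

Definition pencil_det B C : {poly K} :=
  \det (map_mx polyC B + 'X *: map_mx polyC C).

Let corank_diag r : 'rV[{poly K}]_d := \row_i (if (i < r)%N then 1 else 'X).

Let det_corank_diag r : (r <= d)%N ->
  \det (diag_mx (corank_diag r)) = 'X^(d - r).
Proof.
move=> rd; rewrite det_diag.
rewrite (eq_bigr (fun i : 'I_d => if (i < r)%N then 1 else 'X)); last first.
  by move=> i _; rewrite mxE.
rewrite -(big_mkord xpredT (fun i => if (i < r)%N then 1 else 'X)).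
rewrite (big_cat_nat (leq0n r) rd) /= big_nat big1 ?mul1r; last first.
  by move=> i /andP[_ ->].
rewrite big_nat (eq_bigr (fun=> 'X)) => [|i /andP[]]; last first.
  by rewrite leqNgt => /negbTE ->.
by rewrite -big_nat prodr_const_nat.
Qed.

(* Writing B = L pid_mx(r) U turns the pencil into L (pid_mx(r) + 'X D) U, whose
   middle factor has its last d - r rows divisible by 'X. *)
Let pencilE B D :
  map_mx polyC B + 'X *: (map_mx polyC (col_ebase B) *m D *m
    map_mx polyC (row_ebase B)) =
  map_mx polyC (col_ebase B) *m (pid_mx (\rank B) + 'X *: D) *m
    map_mx polyC (row_ebase B).
Proof.
rewrite mulmxDr mulmxDl -scalemxAr -scalemxAl; congr (_ + _).
by rewrite -{1}[B]mulmx_ebase !map_mxM map_pid_mx.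
Qed.

(** The middle factor in [pencilE] contributes ['X^(d - r)] to the determinant, where
    [r = \rank B]. *)
Lemma pencil_det_coef_lt B C i : (i < d - \rank B)%N ->
  (pencil_det B C)`_i = 0.
Proof.
move=> ir; set L := map_mx polyC (col_ebase B).
set U := map_mx polyC (row_ebase B).
(* [D] is [C] in the bases that bring [B] to the form [pid_mx]. *)
pose D := map_mx polyC (invmx (col_ebase B) *m C *m invmx (row_ebase B)).
have CE : map_mx polyC C = L *m D *m U.
  rewrite -!map_mxM !mulmxA mulmxV ?col_ebase_unit// mul1mx -mulmxA.
  by rewrite mulVmx ?row_ebase_unit// mulmx1.
(* [E] is the middle factor with ['X] divided out of the rows where [pid_mx] vanishes. *)
pose E := \matrix_(i, j) (if (i < \rank B)%N
                          then (pid_mx (\rank B) + 'X *: D) i j else D i j).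
have DE : pid_mx (\rank B) + 'X *: D = diag_mx (corank_diag (\rank B)) *m E.
  apply/matrixP => a b; rewrite mul_diag_mx !mxE.
  by case: ifP; rewrite ?mul1r// andbF add0r.
rewrite /pencil_det CE pencilE DE !det_mulmx det_corank_diag ?rank_leq_row//.
by rewrite mulrCA -mulrA coefXnM ir.
Qed.

(** Filling the zero diagonal entries of the normal form of [B] by [copid_mx] makes the middle
    factor diagonal, with entries 1 and ['X]. The coefficient is then the product of the two nonzero
    determinants of the base changes. *)
Lemma pencil_det_coef_exists B : exists C, (pencil_det B C)`_(d - \rank B) != 0.
Proof.
exists (col_ebase B *m copid_mx (\rank B) *m row_ebase B).
rewrite /pencil_det !map_mxM map_copid_mx pencilE.
have -> : pid_mx (\rank B) + 'X *: copid_mx (\rank B) =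
    diag_mx (corank_diag (\rank B)).
  apply/matrixP => a b; rewrite !mxE -[val a == val b]/(a == b).
  have [->|ab] := eqVneq a b; last by rewrite /= subrr mulr0 addr0.
  by case: ifP => _; rewrite ?subrr ?mulr0 ?addr0// subr0 mulr1 add0r.
rewrite !det_mulmx det_corank_diag ?rank_leq_row// !det_map_mx mulrAC -polyCM.
rewrite coefCM coefXn eqxx mulr1 mulf_neq0// -unitfE -unitmxE.
  exact: col_ebase_unit.
exact: row_ebase_unit.
Qed.

End Pencil.

(** * Simultaneous nonvanishing at a generic point *)

Section Generic.

(** Stands in for polynomial functions of several variables: restrictions to lines suffice to find
    generic points. *)
Definition poly_on_lines (K : fieldType) (V : lmodType K) (f : V -> K) :=
  forall v w, exists p : {poly K}, forall s, f (v + s *: w) = p.[s].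

Variables (K : closedFieldType) (V : lmodType K).

(* On the line joining a point where f is nonzero to one where g is nonzero,
   both restrict to nonzero univariate polynomials. *)
Lemma poly_on_lines_mul_neq0 (f g : V -> K) :
  poly_on_lines f -> poly_on_lines g ->
  (exists v, f v != 0) -> (exists v, g v != 0) -> exists v, f v * g v != 0.
Proof.
move=> fP gP [v fv] [w gw].
have [[p pE] [q qE]] := (fP v (w - v), gP v (w - v)).
have p0 : p != 0.
  apply: contraNneq fv => p0; have := pE 0.
  by rewrite p0 horner0 scale0r addr0 => ->.
have q0 : q != 0.
  apply: contraNneq gw => q0; have := qE 1.
  by rewrite q0 horner0 scale1r addrC subrK => ->.
have /closed_nonrootP[s ns] : p * q != 0 by rewrite mulf_neq0.
by exists (v + s *: (w - v)); rewrite pE qE -hornerM.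
Qed.

Lemma poly_on_lines_prod (I : Type) (r : seq I) (f : I -> V -> K) :
  (forall i, poly_on_lines (f i)) ->
  poly_on_lines (fun v => \prod_(i <- r) f i v).
Proof.
move=> fP v w; elim: r => [|i r [p pE]].
  by exists 1 => s; rewrite big_nil hornerC.
have [q qE] := fP i v w; exists (q * p) => s.
by rewrite big_cons hornerM pE qE.
Qed.

(** The conditions are added one at a time, those already met being gathered in a single product. *)
Lemma poly_on_lines_generic (I : finType) (f : I -> V -> K) :
  (forall i, poly_on_lines (f i)) -> (forall i, exists v, f i v != 0) ->
  exists v, forall i, f i v != 0.
Proof.
move=> fP fn0; suff [v] : exists v, \prod_(i <- enum I) f i v != 0.
  rewrite prodf_seq_neq0 => /allP fv; exists v => i.
  by apply: fv; rewrite mem_enum.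
elim: (enum I) => [|i r IH]; first by exists 0; rewrite big_nil oner_eq0.
have [v fv] :=
  poly_on_lines_mul_neq0 (fP i) (poly_on_lines_prod r fP) (fn0 i) IH.
by exists v; rewrite big_cons.
Qed.

End Generic.

Lemma poly_on_lines_pencil (K : fieldType) n d (B : 'M[K]_(d, n)) I k :
  poly_on_lines
    (fun C : 'M[K]_(d, n) => (pencil_det (columns B I) (columns C I))`_k).
Proof.
move=> V W.
(* The outer variable is that of the pencil, the inner one the parameter of the line. Evaluating the
   inner one at [s] commutes with determinants and with taking coefficients. *)
pose P : {poly {poly K}} := \det (
  map_mx (polyC \o polyC) (columns B I) +
  'X *: (map_mx (polyC \o polyC) (columns V I) +
         'X%:P *: map_mx (polyC \o polyC) (columns W I))).
exists P`_k => s; rewrite -[RHS]/(horner_eval s P`_k) -coef_map -det_map_mx.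
rewrite /pencil_det; congr (polyseq (\det _))`_k; apply/matrixP => i j.
rewrite !mxE !(rmorphD, rmorphM) /= map_polyX !map_polyC /= /horner_eval.
by rewrite !hornerC hornerX.
Qed.

Theorem theorem35 (R : realType) (K : closedFieldType) (n d : nat)
    (M : matroid 'I_n) (hM : matroid_rank M = d) :
  plucker_liftable K [ffun S => (corank_vector d M S)%:R : R] <->
  realizable d K M.
Proof.
have liftE (A : 'M[puiseux K]_(d, n)) I :
    puiseux_val R (\det (columns A I)) =
      ([ffun S => (corank_vector d M S)%:R : R] I)%:E <->
    lowest_exponent (\det (columns A I)) (d - matroid_rk M (val I))%:R.
  by rewrite !ffunE -(puiseux_valP R) ratr_nat.
split=> [[A /(_ _)/liftE Alow]|[B basesB]].
  have [J Jind [_ cardJ]] := matroid_rk_witness M [set: 'I_n].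
  rewrite -/(matroid_rank M) hM in cardJ.
  pose I0 : dsubset n d := Sub J (introT eqP cardJ).
  have detA I : supp_ge 0 (\det (columns A I)).
    by move=> q /(Alow I).2; apply: le_trans; rewrite ler0n.
  (* A nonzero coefficient at 0 forces the truncated difference [d - rk] to be 0, that is,
     [rk >= d]; the other inequality comes from the rank of [M]. *)
  have detA0 I :
      (pcoef (\det (columns A I)) 0 != 0) = (val I \in matroid_bases M).
    rewrite matroid_bases_rk ?hM ?(eqP (valP I))//.
    apply/idP/eqP => [/(Alow I).2|rkI].
      rewrite lern0 subn_eq0 => dI; apply/eqP; rewrite eqn_leq dI andbT.
      by have := matroid_rk_rank M (val I); rewrite hM.
    by have [] := Alow I; rewrite rkI subnn.
  pose A' := \adj (columns A I0) *m A.
  have A'ge i j : supp_ge 0 (A' i j).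
    rewrite /A' columnsE adj_mulmx_colsub.
    have [->|[I [b ->]]] := det_colsub A
        (fun l => if l == i then j else column_index I0 l).
      exact: (residue0 K).1.
    apply: (residueM _ (residueS (detA I))).1.
    by apply: residueX; apply/residueN/residue1.
  pose B := \matrix_(i, j) pcoef (A' i j) 0.
  have A'B I : residue (\det (columns A' I)) (\det (columns B I)).
    apply: residue_det => i j; rewrite !columnsE [colsub _ A' _ _]mxE.
    rewrite [colsub _ B _ _]mxE [B _ _]mxE; exact: residueS.
  have detA'B I : pcoef (\det (columns A I0)) 0 * \det (columns B I) =
      pcoef (\det (columns A I0)) 0 ^+ d * pcoef (\det (columns A I)) 0.
    have r0 := residueS (detA I0).
    have [_ <-] := residueM r0 (A'B I).
    have [_ <-] := residueM (residueX d r0) (residueS (detA I)).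
    congr (pcoef _ 0).
    rewrite [columns A' I]columnsE -mulmx_colsub -columnsE det_mulmx.
    (* The block at [I0] times its adjugate is a scalar matrix, whose determinant is the [d]-th
       power of the minor. *)
    rewrite mulrA -[\det _ * \det (\adj _)]det_mulmx.
    by rewrite mul_mx_adj det_scalar.
  have pivot : pcoef (\det (columns A I0)) 0 != 0.
    by rewrite detA0 matroid_basesE Jind hM cardJ eqxx.
  have detB I : (\det (columns B I) != 0) = (val I \in matroid_bases M).
    rewrite -detA0; have /(congr1 (fun x => x == 0)) := detA'B I.
    by rewrite !mulf_eq0 expf_eq0 (negbTE pivot) andbF /= => ->.
  exists B; apply/setP => S; apply/idP/imsetP => [Sbase|[I]]; last first.
    by rewrite inE detB => SI ->.
  have cardS : #|S| == d by move: Sbase; rewrite matroid_basesE hM => /andP[].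
  by exists (Sub S cardS : dsubset n d) => //; rewrite inE detB.
(* The coefficient that must survive: since [B] realizes [M], its index is the corank of [I]. *)
pose f I C :=
  (pencil_det (columns B I) (columns C I))`_(d - \rank (columns B I)).
have [||C Cgen] := @poly_on_lines_generic K 'M[K]_(d, n) _ f.
- by move=> I; exact: poly_on_lines_pencil.
- move=> I; have [D Dn0] := pencil_det_coef_exists (columns B I).
  by have [C CE] := columns_onto I D; exists C; rewrite /f CE.
exists (map_mx (@poly_puiseux K) (map_mx polyC B + 'X *: map_mx polyC C)) => I.
apply/liftE; rewrite columns_map det_map_mx (matroid_rkE hM basesB).
rewrite -rank_columns.
have -> : \det (columns (map_mx polyC B + 'X *: map_mx polyC C) I) =
    pencil_det (columns B I) (columns C I).
  by congr (\det _); apply/matrixP => i j; rewrite !mxE.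
apply: lowest_exponent_poly => [|i]; first exact: Cgen.
exact: pencil_det_coef_lt.
Qed.
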